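(* Let $S$ be a linear operator on a Hilbert space $\mathcal{H}$. The following statements are equivalent: (i) $S$ is (densely defined and) selfadjoint; (ii) (a) $S\wedge S$; (b) $\operatorname{ran}M_{S,S}(\lambda)=\mathcal{H}\times\mathcal{H}$ for a certain (and also for all) $\lambda\in\mathbb{R}$, $\lambda\neq0$; (iii) (a) $S$ is closed and densely defined; (b) $S\wedge S$; (c) $\operatorname{ran}(\lambda^2+S^2)=\mathcal{H}$ for a certain (and also for all) $\lambda\in\mathbb{R}$, $\lambda\neq0$. If $S^2$ is also closed, then condition (iii)(c) can be replaced by (c') $\overline{\operatorname{ran}(\lambda^2+S^2)}=\mathcal{H}$ for a certain (and also for all) $\lambda\in\mathbb{R}$, $\lambda\neq0$.
   Context: Hilbert spaces are real or complex. A linear operator $S$ on $\mathcal{H}$ is a linear map $S:\operatorname{dom}S\to\mathcal{H}$ defined on a linear subspace $\operatorname{dom}S\subseteq\mathcal{H}$; it is not assumed bounded, closed or densely defined unless stated. Equality of operators includes equality of domains; $\operatorname{dom}(S^2)=\{h\in\operatorname{dom}S:Sh\in\operatorname{dom}S\}$, and $\lambda^2+S^2$ is defined on $\operatorname{dom}(S^2)$. The adjoint $S^*$ of a densely defined $S$ has domain $\{k:\exists h'\ \forall h\in\operatorname{dom}S,\ \langle Sh,k\rangle=\langle h,h'\rangle\}$ and $S^*k:=h'$. $S$ is selfadjoint if it is densely defined and $S=S^*$. $S\wedge S$ means $\langle Sh,k\rangle=\langle h,Sk\rangle$ for all $h,k\in\operatorname{dom}S$ ($S$ is symmetric, not necessarily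 densely defined). For a scalar $\lambda$, $M_{S,S}(\lambda)=\begin{pmatrix}\lambda&-S\\S&\lambda\end{pmatrix}$ is the operator on $\mathcal{H}\times\mathcal{H}$ with domain $\operatorname{dom}S\times\operatorname{dom}S$ given by $(h,k)\mapsto(\lambda h-Sk,\ Sh+\lambda k)$. ''For a certain (and also for all) $\lambda$'' means: the statement with ''for some $\lambda$'' and the statement with ''for all $\lambda$'' are both equivalent to the other listed statements. *)

(* Defs.v *)
From HB Require Import structures.
From mathcomp Require Import all_boot all_order all_algebra.
From mathcomp Require Import complex.
From mathcomp Require Import boolp classical_sets reals topology normedtype.

Set Implicit Arguments.
Unset Strict Implicit.
Unset Printing Implicit Defensive.

Import Order.TTheory GRing.Theory Num.Theory.
Import numFieldNormedType.Exports.

Local Open Scope classical_set_scope.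
Local Open Scope ring_scope.

Inductive scalar_kind := RealScalars | ComplexScalars.

Definition scalars (R : realType) (s : scalar_kind) : numFieldType :=
  match s with RealScalars => R | ComplexScalars => R[i] end.

Definition scalar_conj (R : realType) (s : scalar_kind) :
    {rmorphism scalars R s -> scalars R s} :=
  match s return {rmorphism scalars R s -> scalars R s} with
  | RealScalars => idfun
  | ComplexScalars => (@Num.conj R[i] : {rmorphism R[i] -> R[i]})
  end.

(* The inner product is linear in its first argument and conjugate-linear in
   its second one. *)
HB.mixin Record CompleteNormedModule_isHilbert (R : realType) (s : scalar_kind)
    H of CompleteNormedModule (scalars R s) H := {
  inner : {dot H for scalar_conj R s} ;
  sqr_norm_inner : forall x : H, `|x| ^+ 2 = inner x x
}.

#[short(type="hilbertType")]
HB.structure Definition Hilbert (R : realType) (s : scalar_kind) :=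
  { H of CompleteNormedModule (scalars R s) H &
         CompleteNormedModule_isHilbert R s H }.

(* The values of [op_fun] outside [dom] are irrelevant: every notion below
   evaluates an operator on its domain only. *)
Record linop (K : numFieldType) (V : lmodType K) := LinOp {
  dom : set V ;
  op_fun :> V -> V ;
  dom0 : dom 0 ;
  domP : forall (a : K) (u v : V), dom u -> dom v -> dom (a *: u + v) ;
  op_linear : forall (a : K) (u v : V),
    dom u -> dom v -> op_fun (a *: u + v) = a *: op_fun u + op_fun v
}.

Section LinOp.
Variables (K : numFieldType) (V : lmodType K).
Implicit Types (S T : linop V) (c : K).

Definition eqop S T := dom S = dom T /\ forall h, dom S h -> S h = T h.

Definition ran S : set V := S @` dom S.

Definition graph S : set (V * V) := [set (h, S h) | h in dom S].

Lemma op0 S : S 0 = 0.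
Proof.
have := op_linear (-1) (dom0 S) (dom0 S).
by rewrite !scaleN1r oppr0 addr0 addNr.
Qed.

Lemma sqr_dom0 S : dom S 0 /\ dom S (S 0).
Proof. by rewrite op0; split; exact: dom0. Qed.

Lemma sqr_domP S (a : K) (u v : V) :
  dom S u /\ dom S (S u) -> dom S v /\ dom S (S v) ->
  dom S (a *: u + v) /\ dom S (S (a *: u + v)).
Proof.
move=> [Su SSu] [Sv SSv]; split; first exact: domP.
by rewrite op_linear//; exact: domP.
Qed.

Lemma sqr_linear S (a : K) (u v : V) :
  dom S u /\ dom S (S u) -> dom S v /\ dom S (S v) ->
  S (S (a *: u + v)) = a *: S (S u) + S (S v).
Proof. by move=> [Su SSu] [Sv SSv]; rewrite !op_linear. Qed.

Definition sqr_op S : linop V :=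
  @LinOp K V [set h | dom S h /\ dom S (S h)] (fun h => S (S h))
    (sqr_dom0 S) (@sqr_domP S) (@sqr_linear S).

Lemma add_scalar_linear c S (a : K) (u v : V) :
  dom S u -> dom S v ->
  c *: (a *: u + v) + S (a *: u + v)
  = a *: (c *: u + S u) + (c *: v + S v).
Proof.
move=> Su Sv; rewrite op_linear// !scalerDr !scalerA (mulrC c a) addrACA.
by [].
Qed.

(* the operator c + S *)
Definition add_scalar_op c S : linop V :=
  @LinOp K V (dom S) (fun h => c *: h + S h)
    (dom0 S) (@domP K V S) (@add_scalar_linear c S).

Lemma block_dom0 S : dom S (0 : V * V).1 /\ dom S (0 : V * V).2.
Proof. by split; exact: dom0. Qed.

Lemma block_domP S (a : K) (p q : V * V) :
  dom S p.1 /\ dom S p.2 -> dom S q.1 /\ dom S q.2 ->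
  dom S (a *: p + q).1 /\ dom S (a *: p + q).2.
Proof. by move=> [? ?] [? ?]; split; exact: domP. Qed.

Lemma block_linear c S (a : K) (p q : V * V) :
  dom S p.1 /\ dom S p.2 -> dom S q.1 /\ dom S q.2 ->
  (c *: (a *: p + q).1 - S (a *: p + q).2,
   S (a *: p + q).1 + c *: (a *: p + q).2)
  = a *: (c *: p.1 - S p.2, S p.1 + c *: p.2)
    + (c *: q.1 - S q.2, S q.1 + c *: q.2).
Proof.
move: p q => [p1 p2] [q1 q2] /= [Sp1 Sp2] [Sq1 Sq2].
rewrite !op_linear//; congr pair => /=.
  by rewrite opprD !scalerDr scalerN !scalerA (mulrC c a) addrACA.
by rewrite !scalerDr !scalerA (mulrC c a) addrACA.
Qed.

(* M_{S,S}(c), the operator matrix (c  -S ; S  c) *)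
Definition block_op c S : linop (V * V)%type :=
  @LinOp K (V * V)%type [set p | dom S p.1 /\ dom S p.2]
    (fun p => (c *: p.1 - S p.2, S p.1 + c *: p.2))
    (block_dom0 S) (@block_domP S) (@block_linear c S).

End LinOp.

Section HilbertOp.
Variables (R : realType) (s : scalar_kind) (H : hilbertType R s).
Implicit Types (S : linop H).

Local Notation "'[ u , v ]" := (@inner R s H u v).

Definition densely_defined S := dense (dom S).

Definition closed_op S := closed (graph S).

(* S /\ S; symmetric, but not necessarily densely defined *)
Definition symmetric_op S :=
  forall h k, dom S h -> dom S k -> '[S h, k] = '[h, S k].

Definition adjoint_rel S (k h' : H) :=
  forall h, dom S h -> '[S h, k] = '[h, h'].

Lemma dense_inner0 (D : set H) (w : H) :
  dense D -> (forall h, D h -> '[h, w] = 0) -> w = 0.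
Proof.
move=> dD Dw; apply/eqP/negPn/negP => w0.
have [|h [wh Dh]] := dD _ _ (ball_open w `|w|).
  by exists w; apply: ballxx; rewrite normr_gt0.
move: wh; rewrite -ball_normE /= => wh.
suff: `|w| ^+ 2 <= `|w - h| ^+ 2.
  by rewrite ler_pXn2r ?nnegrE// => /(lt_le_trans wh); rewrite ltxx.
rewrite !sqr_norm_inner.
have wh0 : '[w, h] = 0.
  have /= -> := @hermC _ _ _ _ (@inner R s H) w h.
  by rewrite Dw// rmorph0 mulr0.
have /= -> := hnormBd wh0.
by rewrite lerDl -sqr_norm_inner exprn_ge0.
Qed.

Lemma adjoint_rel0 S : adjoint_rel S 0 0.
Proof. by move=> h Sh; rewrite !linear0r. Qed.

Lemma adjoint_relP S (a : scalars R s) (k l k' l' : H) :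
  adjoint_rel S k k' -> adjoint_rel S l l' ->
  adjoint_rel S (a *: k + l) (a *: k' + l').
Proof. by move=> kk' ll' h Sh; rewrite !linearPr/= kk'// ll'. Qed.

Lemma adjoint_rel_inj S (k h1 h2 : H) : densely_defined S ->
  adjoint_rel S k h1 -> adjoint_rel S k h2 -> h1 = h2.
Proof.
move=> dS k1 k2; apply/eqP; rewrite -subr_eq0; apply/eqP.
apply: (dense_inner0 dS) => h Sh.
by rewrite linearBr/= -k1// -k2// subrr.
Qed.

Definition adjoint_dom S : set H := [set k | exists h', adjoint_rel S k h'].

Definition adjoint_fun S (k : H) : H := xget 0 [set h' | adjoint_rel S k h'].

Lemma adjoint_funP S k : adjoint_dom S k -> adjoint_rel S k (adjoint_fun S k).
Proof. by move=> [h' kh']; exact: (xgetI 0 kh'). Qed.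

Lemma adjoint_dom0 S : adjoint_dom S 0.
Proof. by exists 0; exact: adjoint_rel0. Qed.

Lemma adjoint_domP S (a : scalars R s) (u v : H) :
  adjoint_dom S u -> adjoint_dom S v -> adjoint_dom S (a *: u + v).
Proof.
by move=> [u' uu'] [v' vv']; exists (a *: u' + v'); exact: adjoint_relP.
Qed.

Lemma adjoint_linear S (dS : densely_defined S) (a : scalars R s) (u v : H) :
  adjoint_dom S u -> adjoint_dom S v ->
  adjoint_fun S (a *: u + v) = a *: adjoint_fun S u + adjoint_fun S v.
Proof.
move=> Su Sv; apply: (adjoint_rel_inj dS (k := a *: u + v)).
  exact/adjoint_funP/adjoint_domP.
by apply: adjoint_relP; exact: adjoint_funP.
Qed.

Definition adjoint S (dS : densely_defined S) : linop H :=
  @LinOp _ H (adjoint_dom S) (adjoint_fun S)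
    (adjoint_dom0 S) (@adjoint_domP S) (@adjoint_linear S dS).

Definition selfadjoint S :=
  exists dS : densely_defined S, eqop S (adjoint dS).

End HilbertOp.

(* Main.v *)
Require Import Defs.
From HB Require Import structures.
From mathcomp Require Import all_boot all_order all_algebra.
From mathcomp Require Import boolp classical_sets reals topology normedtype.
From mathcomp Require Import complex ring.

(** For real [c <> 0], write [M] for the operator matrix [(c, -S; S, c)]. Its
    range is the sum of the subspace [A] of the pairs [(c h, S h)] and the
    subspace [B] of the pairs [(- S k, c k)]. Up to scaling, [A] is the graph
    of [S]. If [S] is densely defined with adjoint [S'], then the orthogonal
    complement of [A] consists of the pairs [(- S' k, c k)]; and symmetry of
    [S] says that [B] is orthogonal to [A].

    If [S] is selfadjoint, then [B] is the whole complement of the closed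
    subspace [A], and the projection theorem gives [A + B = H * H]
    ([selfadjoint_block_surjective]). Conversely, if [S] is symmetric and
    [A + B = H * H], then the complement of [A] is [B]; this forces the domain
    to be dense and the adjoint to be [S] ([block_surjective_selfadjoint]).
    One value of [c] suffices here, whereas the first implication provides
    every value, which accounts for the interchange of some and all.

    Surjectivity of [M] and of [c^2 + S^2] are equivalent by elimination of one
    unknown ([sqr_surjective_block], [block_surjective_sqr]). Finally, if [S]
    is symmetric then [c^2 + S^2] is bounded below by [c^2], so that its range
    is closed as soon as [S^2] is ([dense_range_surjective]).

    The projection theorem is obtained from minimising sequences
    ([minimising_sequence]) for a scalar product on a vector space. It is used
    in [H] to prove density and in [H * H] to decompose along [A]. Real and
    complex scalars are treated together: all that depends on the case is that
    [x * conj x = |x|^2], that conjugation fixes real scalars and that the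
    scalars are archimedean. *)

Set Implicit Arguments.
Unset Strict Implicit.
Unset Printing Implicit Defensive.

Import Order.TTheory GRing.Theory Num.Theory.
Import numFieldNormedType.Exports.
Local Open Scope classical_set_scope.
Local Open Scope ring_scope.

(** * Elementary estimates in a field of numbers *)

Section NumFieldIdentities.
Context {K : numFieldType}.
Implicit Types a b c : K.

(** Take two vectors [x] and [y], [a = <y, x>], [b = <x, y>], [c = |y|^2] and
    [d = |x|^2]: the squared norm [d] of [x] drops by [b a / c] when the
    component of [x] along [y] is removed. The term [e] is a tolerance. *)
Lemma residual_expand a b c d e : c != 0 ->
  d + a / c * (b / c * c) - (a / c * b + b / c * a) + e - d = e - b * a / c.
Proof. by move=> c0; field. Qed.

Lemma sqr_sum_le a b : a \is Num.real -> b \is Num.real ->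
  (a + b) ^+ 2 <= 2 * (a ^+ 2 + b ^+ 2).
Proof.
move=> aR bR; rewrite -subr_ge0.
have -> : 2 * (a ^+ 2 + b ^+ 2) - (a + b) ^+ 2 = (a - b) ^+ 2 by ring.
by rewrite real_exprn_even_ge0// rpredB.
Qed.

Lemma double_sum_sqr_le a b : 0 <= a -> 0 <= b ->
  2 * (a ^+ 2 + b ^+ 2) <= (2 * (a + b)) ^+ 2.
Proof.
move=> a0 b0; rewrite -subr_ge0.
have -> : (2 * (a + b)) ^+ 2 - 2 * (a ^+ 2 + b ^+ 2) =
  2 * (a ^+ 2 + b ^+ 2 + 4 * (a * b)) by ring.
by rewrite !(mulr_ge0, addr_ge0, exprn_ge0).
Qed.

End NumFieldIdentities.

(** * Limits and completeness over real or complex scalars *)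

Section Scalars.
Context {R : realType} {s : scalar_kind}.
Implicit Types x y : scalars R s.

Lemma scalar_conj_mul x : x * scalar_conj R s x = `|x| ^+ 2.
Proof.
case: s x => x /=; first by rewrite real_normK ?num_real// expr2.
by rewrite normCK.
Qed.

Lemma scalar_conj_real x : x \is Num.real -> scalar_conj R s x = x.
Proof. by case: s x => x //= /CrealP. Qed.

(** A nonnegative complex number is real, so the field of scalars is
    archimedean in both cases. Near-minimisers of a distance exist for this
    reason, without passing through infima of sets of real numbers. *)
Lemma scalar_archimedean x : 0 <= x -> exists n : nat, x < n%:R.
Proof.
case: s x => x x0; first by exists (Num.Def.archi_bound x); exact: archi_boundP.
have [/eqP xI xR] : complex.Im x == 0 /\ 0 <= complex.Re x.
  by move: x0; rewrite lecE/= => /andP[].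
exists (Num.Def.archi_bound (complex.Re x)).
rewrite -(rmorph_nat (real_complex R)) ltcE/= xI eqxx/=.
exact: archi_boundP.
Qed.

Definition unit_frac (n : nat) : scalars R s := n.+1%:R^-1.

Lemma unit_frac_gt0 n : 0 < unit_frac n.
Proof. by rewrite invr_gt0 ltr0n. Qed.

Lemma unit_frac_small x : 0 < x -> \forall n \near \oo, unit_frac n < x.
Proof.
move=> x0; have [|N xN] := @scalar_archimedean x^-1.
  by rewrite invr_ge0 ltW.
exists N => // n /= Nn; rewrite -[x]invrK ltf_pV2 ?posrE ?invr_gt0 ?ltr0n//.
by rewrite (lt_le_trans xN)// ler_nat ltnW.
Qed.

Lemma cvg_unit_frac (V : normedModType (scalars R s)) (u : nat -> V) (l : V)
    (C : scalars R s) :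
  0 <= C -> (forall n, `|l - u n| <= C * unit_frac n) -> u @ \oo --> l.
Proof.
move=> C0 ul; apply/cvgrPdist_lt => e e0.
have C1 : 0 < C + 1 by rewrite ltr_wpDl.
have := @unit_frac_small (e / (C + 1)); rewrite divr_gt0// => /(_ isT).
apply: filterS => n; rewrite ltr_pdivlMr// => ne; apply: le_lt_trans ne.
rewrite (le_trans (ul n))// mulrC ler_pM2l ?unit_frac_gt0//.
by rewrite lerDl ler01.
Qed.

Lemma cauchy_unit_frac (V : completeNormedModType (scalars R s)) (u : nat -> V)
    (C : scalars R s) : 0 <= C ->
  (forall n m, `|u n - u m| <= C * (unit_frac n + unit_frac m)) ->
  exists l : V, u @ \oo --> l.
Proof.
move=> C0 uC; suff /cauchy_cvgP uc : cauchy (u @ \oo).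
  by exists (lim (u @ \oo)); exact: uc.
apply: cauchy_exP => e e0.
have C1 : 0 < C + 1 by rewrite ltr_wpDl.
have := @unit_frac_small (e / (C + 1) / 2); rewrite !divr_gt0// => /(_ isT).
move=> [N _ Ns]; exists (u N); exists N => // n /= Nn.
rewrite -ball_normE /=; apply: (le_lt_trans (uC _ _)).
have nN : unit_frac N + unit_frac n < e / (C + 1).
  by rewrite [ltRHS]splitr ltrD// Ns//=.
move: nN; rewrite ltr_pdivlMr//; apply: le_lt_trans.
rewrite mulrC ler_pM2l ?lerDl ?ler01//.
by rewrite addr_gt0 ?unit_frac_gt0.
Qed.

Lemma closure_cvg (V : normedModType (scalars R s)) (A : set V) (x : V) :
  closure A x ->
  exists2 d : nat -> V, forall n, A (d n) & forall n, `|x - d n| <= unit_frac n.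
Proof.
move=> Ax; have /choice[d dP] n : exists z, A z /\ `|x - z| <= unit_frac n.
  have [|z [Az]] := Ax (ball x (unit_frac n)).
    by apply: nbhsx_ballx; exact: unit_frac_gt0.
  by rewrite -ball_normE => /ltW; exists z.
by exists d => n; have [] := dP n.
Qed.

Lemma cvg_sqr_small0 (z : nat -> (scalars R s)^o) (w : (scalars R s)^o)
    (C : scalars R s) :
  z @ \oo --> w -> 0 <= C ->
  (forall n, `|z n| ^+ 2 <= unit_frac n ^+ 2 * C) -> w = 0.
Proof.
move=> zw C0 zC; have C1 : 0 <= C + 1 by rewrite addr_ge0.
suff z0 : z @ \oo --> (0 : (scalars R s)^o)
  by exact: (cvg_unique (@norm_hausdorff _ (scalars R s)^o) zw z0).
apply: (@cvg_unit_frac (scalars R s)^o _ _ (C + 1)) => // n.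
have a0 : 0 <= unit_frac n :> scalars R s by rewrite ltW// unit_frac_gt0.
rewrite sub0r normrN -(@ler_pXn2r _ 2)// ?nnegrE ?mulr_ge0//.
rewrite (le_trans (zC n))// mulrC exprMn ler_wpM2r ?exprn_ge0//.
rewrite expr2 mulrDr mulr1 mulrDl mul1r addrAC lerDr.
by rewrite !addr_ge0// mulr_ge0.
Qed.

End Scalars.

(** * Minimising sequences for the distance to a subspace *)

Section Projection.
Context {R : realType} {s : scalar_kind} {V : lmodType (scalars R s)}.
Variable (f : {dot V for scalar_conj R s}).
Local Notation K := (scalars R s).
Local Notation "'[ u , v ]" := (f u v).
Local Notation "'[ u ]" := (f u u).

Lemma dotC u v : '[u, v] = scalar_conj R s '[v, u].
Proof. by have /= -> := @hermC _ _ _ _ f u v; rewrite mul1r. Qed.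

Lemma dotZl a u v : '[a *: u, v] = a * '[u, v].
Proof. by rewrite linearZl_LR. Qed.

Lemma dotZr a u v : '[u, a *: v] = scalar_conj R s a * '[u, v].
Proof. by rewrite linearZr_LR. Qed.

Lemma dot_ge0 u : 0 <= '[u].
Proof.
have [->|u0] := eqVneq u 0; first by rewrite linear0l.
by rewrite ltW// (neq0_dnorm_gt0 u).
Qed.

Lemma dot_eq0 u : '[u] = 0 -> u = 0.
Proof.
by move=> /eqP; apply: contraTeq => /(@neq0_dnorm_gt0 _ _ _ f)/gt_eqF->.
Qed.

Lemma dotB u v : '[u - v] = '[u] + '[v] - ('[u, v] + '[v, u]).
Proof. by rewrite linearBl/= !linearBr/=; ring. Qed.

(** If moving [r] along [e] cannot decrease [|r|^2] by more than [eps], then [r]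
    is nearly orthogonal to [e]: the best move is
    [t = <r, e> / |e|^2], and it gains [|<r, e>|^2 / |e|^2]. The case
    [eps = |r|^2] is the Cauchy-Schwarz inequality. *)
Lemma near_minimal_dot (r e : V) (eps : K) :
  (forall t : K, '[r] <= '[r - t *: e] + eps) -> `|'[r, e]| ^+ 2 <= eps * '[e].
Proof.
move=> rmin; have [->|e0] := eqVneq e 0.
  by rewrite linear0r linear0l normr0 expr0n mulr0.
have e_gt0 := @neq0_dnorm_gt0 _ _ _ f _ e0.
have := rmin ('[r, e] / '[e]).
rewrite dotB !dotZr !dotZl fmorph_div /=.
rewrite (@scalar_conj_real _ _ _ (gtr0_real e_gt0)).
rewrite -(dotC e) -scalar_conj_mul -(dotC e).
have qe0 : '[e] != 0 by rewrite gt_eqF.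
rewrite -subr_ge0.
rewrite residual_expand//.
by rewrite subr_ge0 ler_pdivrMr.
Qed.

Lemma dot_CauchySchwarz u v : `|'[u, v]| ^+ 2 <= '[u] * '[v].
Proof. by apply: near_minimal_dot => t; rewrite lerDr dot_ge0. Qed.

Variable D : set V.
Hypothesis D0 : D 0.
Hypothesis DP : forall (a : K) u v, D u -> D v -> D (a *: u + v).

(** Otherwise one could decrease the squared distance by [eps] again and again,
    and it would become negative after finitely many steps. *)
Lemma near_minimiser (x : V) (eps : K) : 0 < eps ->
  exists2 d, D d & forall d', D d' -> '[x - d] <= '[x - d'] + eps.
Proof.
move=> eps0; apply: contrapT => nex.
have descend d : D d -> exists2 d', D d' & '[x - d'] + eps <= '[x - d].
  move=> Dd; apply: contrapT => nd; apply: nex; exists d => // d' Dd'.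
  rewrite real_leNgt ?ger0_real ?addr_ge0 ?dot_ge0// ?ltW//.
  by apply/negP => /ltW ?; apply: nd; exists d'.
have steps n : exists2 d, D d & '[x - d] + eps *+ n <= '[x].
  elim: n => [|n [d Dd dn]]; first by exists 0 => //; rewrite subr0 addr0.
  have [d' Dd' d'd] := descend d Dd; exists d' => //.
  by rewrite mulrS addrA (le_trans _ dn)// lerD2r.
have [|n] := @scalar_archimedean R s ('[x] / eps).
  by rewrite divr_ge0 ?dot_ge0 ?ltW.
rewrite ltr_pdivrMr// mulr_natl.
have [d Dd dn] := steps n.
move=> /(le_lt_trans dn); rewrite -ltrBrDr subrr.
by move=> /(le_lt_trans (dot_ge0 _)); rewrite ltxx.
Qed.

(** The algebraic core of the projection theorem. The tolerance is the square
    of [unit_frac n], so that the residuals [x - d n] are orthogonal to [D] up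
    to [unit_frac n]. Since [e = d n - d m] is in [D] and is the difference of
    two residuals, [|e|^2] is the difference of their products with [e], both
    small compared with [|e|]: the sequence is Cauchy for the norm of the
    form. *)
Lemma minimising_sequence (x : V) : exists d : nat -> V,
  [/\ forall n, D (d n),
      forall n m, '[d n - d m] <=
        (2 * (unit_frac n + unit_frac m)) ^+ 2
    & forall n e, D e -> `|'[x - d n, e]| ^+ 2 <= unit_frac n ^+ 2 * '[e]].
Proof.
have /choice[d dP] n : exists d, D d /\
    forall d', D d' -> '[x - d] <= '[x - d'] + (unit_frac n) ^+ 2.
  have [|d ? ?] := @near_minimiser x (unit_frac n ^+ 2); last by exists d.
  by rewrite exprn_gt0// unit_frac_gt0.
have dD n := (dP n).1.
have res n e : D e -> `|'[x - d n, e]| ^+ 2 <= unit_frac n ^+ 2 * '[e].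
  move=> De; apply: near_minimal_dot => t.
  by rewrite -addrA -opprD [d n + _]addrC; exact/(dP n).2/DP.
exists d; split => // n m.
set a : K := unit_frac n; set b : K := unit_frac m.
have ab0 : 0 <= a + b by rewrite addr_ge0// ltW// unit_frac_gt0.
have a0 : 0 <= a by rewrite ltW// unit_frac_gt0.
have b0 : 0 <= b by rewrite ltW// unit_frac_gt0.
set e := d n - d m.
have De : D e by rewrite /e -scaleN1r addrC; exact: DP.
have [->|e0] := eqVneq e 0; first by rewrite linear0l exprn_ge0// mulr_ge0.
have e_gt0 := @neq0_dnorm_gt0 _ _ _ f _ e0.
have eE : '[e] = '[x - d m, e] - '[x - d n, e].
  by rewrite -linearBl/=; congr (f _ e); rewrite opprB [RHS]addrC subrKA.
rewrite -(ler_pM2r e_gt0).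
suff : '[e] * '[e] <= 2 * (a ^+ 2 + b ^+ 2) * '[e].
  by move=> /le_trans; apply; rewrite ler_pM2r// double_sum_sqr_le.
have /le_trans : '[e] * '[e] <= (`|'[x - d m, e]| + `|'[x - d n, e]|) ^+ 2.
  rewrite -expr2 ler_pXn2r ?nnegrE ?dot_ge0 ?addr_ge0//.
  by rewrite -[leLHS]ger0_norm ?dot_ge0// {1}eE ler_normB.
apply.
set p := `|_|; set q := `|_|.
apply: (le_trans (@sqr_sum_le _ p q _ _)); rewrite ?normr_real//.
by rewrite -mulrA ler_pM2l// addrC mulrDl lerD ?res.
Qed.

End Projection.

(** * Projection in a Hilbert space and in its square *)

Section Hilbert.
Context {R : realType} {s : scalar_kind} {H : hilbertType R s}.
Local Notation K := (scalars R s).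
Local Notation "'[ u , v ]" := (@inner R s H u v).
Implicit Types (u v w x y : H) (p q : H * H) (D : set H).

Lemma norm_inner u v : `|'[u, v]| <= `|u| * `|v|.
Proof.
rewrite -(@ler_pXn2r _ 2)// ?nnegrE ?mulr_ge0// exprMn !sqr_norm_inner.
exact: dot_CauchySchwarz.
Qed.

Lemma inner_cvgl (u_ : nat -> H) u v :
  u_ @ \oo --> u -> (fun n => '[u_ n, v] : K^o) @ \oo --> ('[u, v] : K^o).
Proof.
move=> uu; apply/cvgrPdist_lt => e e0.
have v1 : 0 < `|v| + 1 by rewrite ltr_wpDl.
move/cvgrPdist_lt : uu => /(_ (e / (`|v| + 1))); rewrite divr_gt0// => /(_ isT).
apply: filterS => n; rewrite ltr_pdivlMr//; apply: le_lt_trans.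
rewrite -linearBl/= (le_trans (norm_inner _ _))// ler_wpM2l//.
by rewrite lerDl ler01.
Qed.

(** The Hilbert space structure of [H * H]; the norm with which the product type
    comes is the maximum of the norms of the components, which defines the same
    topology but no scalar product. *)
Definition inner2 p q : K := '[p.1, q.1] + '[p.2, q.2].

Let inner2_bilinear : bilinear_for
  (GRing.Scale.Law.clone _ _ ( *%R ) _)
  (GRing.Scale.Law.clone _ _ (scalar_conj R s \; *%R ) _) inner2.
Proof.
split=> p a q r; rewrite /inner2/=.
  by rewrite !linearPl/= mulrDr addrACA.
by rewrite !linearPr/= mulrDr addrACA.
Qed.

HB.instance Definition _ := @bilinear_isBilinear.Build
  K (H * H)%type (H * H)%type K _ _ inner2 inner2_bilinear.

Let inner2_hermitian p q :
  inner2 p q = (-1) ^+ false * scalar_conj R s (inner2 q p).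
Proof. by rewrite mul1r rmorphD/= -!dotC. Qed.

HB.instance Definition _ := @isHermitianSesquilinear.Build
  K (H * H)%type false (scalar_conj R s) inner2 inner2_hermitian.

Let inner2_gt0 p : p != 0 -> 0 < inner2 p p.
Proof.
case: p => u v; rewrite /inner2/= => uv0.
have [u0|u0] := eqVneq u 0; last first.
  by rewrite ltr_pwDl ?dot_ge0// neq0_dnorm_gt0.
rewrite ltr_wpDl ?dot_ge0// neq0_dnorm_gt0//.
by apply: contra_neq uv0 => ->; rewrite u0.
Qed.

HB.instance Definition _ :=
  @isDotProduct.Build K (H * H)%type inner2 inner2_gt0.

(** The limit [l] of the minimising sequence is the projection of [x] on the
    closure of [D]. *)
Lemma project D x : D 0 ->
  (forall (a : K) u v, D u -> D v -> D (a *: u + v)) ->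
  exists (d : nat -> H) (l : H),
    [/\ forall n, D (d n), d @ \oo --> l & forall e, D e -> '[x - l, e] = 0].
Proof.
move=> D0 DP.
have [d [dD dd res]] := @minimising_sequence _ _ _ (@inner R s H) D D0 DP x.
have [|n m|l dl] := @cauchy_unit_frac _ _ H d 2; first by [].
  rewrite -(@ler_pXn2r _ 2)// ?nnegrE ?mulr_ge0 ?addr_ge0
    ?(ltW (unit_frac_gt0 _))//.
  by rewrite sqr_norm_inner; exact: dd.
exists d, l; split => // e De; apply: (@cvg_sqr_small0 _ _ _ _ '[e, e]).
- by apply: inner_cvgl; apply: cvgB dl; exact: cvg_cst.
- exact: dot_ge0.
- by move=> n; exact: res.
Qed.

(** Both components of the minimising sequence are Cauchy, because [inner2]
    bounds each of them. *)
Lemma project2 (D : set (H * H)) p : D 0 ->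
  (forall (a : K) q r, D q -> D r -> D (a *: q + r)) ->
  exists (d : nat -> H * H) (l : H * H),
    [/\ forall n, D (d n), d @ \oo --> l
      & forall e, D e -> inner2 (p - l) e = 0].
Proof.
move=> D0 DP.
have [d [dD dd res]] := @minimising_sequence _ _ _ inner2 D D0 DP p.
have a0 n : 0 <= unit_frac n :> K by rewrite ltW// unit_frac_gt0.
have [|n m|l1 dl1] := @cauchy_unit_frac _ _ H (fst \o d) 2; first by [].
  rewrite -(@ler_pXn2r _ 2)// ?nnegrE ?mulr_ge0 ?addr_ge0//.
  by apply: le_trans (dd n m); rewrite sqr_norm_inner lerDl dot_ge0.
have [|n m|l2 dl2] := @cauchy_unit_frac _ _ H (snd \o d) 2; first by [].
  rewrite -(@ler_pXn2r _ 2)// ?nnegrE ?mulr_ge0 ?addr_ge0//.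
  by apply: le_trans (dd n m); rewrite sqr_norm_inner lerDr dot_ge0.
exists d, (l1, l2); split => //.
  have -> : d = fun n => ((fst \o d) n, (snd \o d) n).
    by apply/funext => n /=; case: (d n).
  exact: cvg_pair.
move=> e De; apply: (@cvg_sqr_small0 _ _ _ _ (inner2 e e)).
- by apply: cvgD; apply: inner_cvgl; apply: cvgB; [exact: cvg_cst|exact: dl1|
    exact: cvg_cst|exact: dl2].
- exact: dot_ge0.
- by move=> n; exact: res.
Qed.

Lemma dense_of_orthogonal D : D 0 ->
  (forall (a : K) u v, D u -> D v -> D (a *: u + v)) ->
  (forall w, (forall e, D e -> '[w, e] = 0) -> w = 0) -> dense D.
Proof.
move=> D0 DP Dorth O [x Ox] oO.
have [d [l [dD dl xl]]] := @project D x D0 DP.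
have lx : l = x by apply/esym/eqP; rewrite -subr_eq0; apply/eqP; exact: Dorth.
have : nbhs l O by rewrite lx; exact: open_nbhs_nbhs.
by move=> /dl /= [N _ /(_ N (leqnn N))]; exists (d N).
Qed.

End Hilbert.

(** * Symmetric and selfadjoint operators *)

Section Operators.
Context {R : realType} {s : scalar_kind} {H : hilbertType R s}.
Local Notation K := (scalars R s).
Local Notation "'[ u , v ]" := (@inner R s H u v).
Implicit Types (S : linop H) (c : K) (h k l u : H).

Lemma domZ S c u : dom S u -> dom S (c *: u).
Proof.
by move=> Su; rewrite -[_ *: _]addr0; apply: domP => //; exact: dom0.
Qed.

Lemma opZ S c u : dom S u -> S (c *: u) = c *: S u.
Proof.
by move=> Su; rewrite -[c *: u]addr0 op_linear ?op0 ?addr0//; exact: dom0.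
Qed.

(** Swapping the arguments makes the adjoint relation linear, hence closed, in
    the pair [(k, l)] by continuity of the first argument of the scalar
    product. *)
Lemma adjoint_relE S k l :
  adjoint_rel S k l <-> forall h, dom S h -> '[k, S h] = '[l, h].
Proof.
split=> kl h Sh; first by rewrite dotC kl// -dotC.
by rewrite dotC kl// -dotC.
Qed.

(** Selfadjointness with the choice hidden in the adjoint removed: the adjoint
    relation is exactly the graph of [S]. *)
Lemma selfadjoint_adjoint_rel S k l : selfadjoint S ->
  adjoint_rel S k l <-> dom S k /\ S k = l.
Proof.
move=> [dS [domE SE]]; split=> [kl|[Sk <-]].
  have Sk : dom S k by rewrite domE; exists l.
  split=> //; rewrite SE//; apply: (adjoint_rel_inj dS _ kl).
  by apply: adjoint_funP; exists l.
by rewrite SE//; apply: adjoint_funP; rewrite domE in Sk.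
Qed.

Lemma selfadjoint_symmetric S : selfadjoint S -> symmetric_op S.
Proof.
move=> sS h k Sh Sk; suff /(_ h Sh) : adjoint_rel S k (S k) by [].
exact/selfadjoint_adjoint_rel.
Qed.

Lemma selfadjoint_closed S : selfadjoint S -> closed_op S.
Proof.
move=> sS p /closure_cvg[d dS dp].
have dlim : d @ \oo --> p.
  by apply: (@cvg_unit_frac _ _ _ _ _ 1) => // n; rewrite mul1r.
have d1 : (fun n => (d n).1) @ \oo --> p.1.
  by apply: cvg_comp dlim _; exact: cvg_fst.
have d2 : (fun n => (d n).2) @ \oo --> p.2.
  by apply: cvg_comp dlim _; exact: cvg_snd.
suff /(selfadjoint_adjoint_rel _ _ sS)[Sp Spp] : adjoint_rel S p.1 p.2.
  by exists p.1 => //; rewrite Spp; case: (p).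
apply/adjoint_relE => h Sh.
suff lim1 : (fun n => '[(d n).1, S h] : K^o) @ \oo --> ('[p.2, h] : K^o).
  exact: (cvg_unique (@norm_hausdorff _ K^o) (inner_cvgl (v := S h) d1) lim1).
have -> : (fun n => '[(d n).1, S h]) = fun n => '[(d n).2, h];
  last exact: inner_cvgl.
apply/funext => n; have [k Sk <-] /= := dS n.
by rewrite selfadjoint_symmetric.
Qed.

(** Decompose [p] along the subspace [D] of the pairs [(c h, S h)], which is
    closed because the graph of [S] is. Orthogonality of the residual [(x, y)]
    to [D] says that [y] is in the domain of the adjoint of [S], hence of [S],
    with [S y = - c x]; so the residual is [(- S k, c k)] for [k = y / c]. *)
Lemma selfadjoint_block_surjective S c : selfadjoint S ->
  c \is Num.real -> c != 0 -> ran (block_op c S) = setT.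
Proof.
move=> sS cR c0; rewrite -subTset => p _.
pose D := [set (c *: h, S h) | h in dom S].
have [||d [l [dD dl orth]]] := @project2 R s H D p.
- by exists 0; [exact: dom0|rewrite scaler0 op0].
- move=> a _ _ [h Sh <-] [k Sk <-]; exists (a *: h + k); first exact: domP.
  rewrite op_linear//; congr pair => /=.
  by rewrite scalerDr !scalerA (mulrC c a).
have [h Sh [hl Shl]] : graph S (c^-1 *: l.1, l.2).
  have dl1 : (fun n => c^-1 *: (d n).1) @ \oo --> c^-1 *: l.1.
    by apply: cvgZr; apply: cvg_comp dl _; exact: cvg_fst.
  have dl2 : (fun n => (d n).2) @ \oo --> l.2.
    by apply: cvg_comp dl _; exact: cvg_snd.
  have dl12 : (fun n => (c^-1 *: (d n).1, (d n).2)) @ \oo -->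
      ((c^-1 *: l.1, l.2) : H * H) by exact: cvg_pair.
  apply: (closed_cvg _ (selfadjoint_closed sS) _ _ dl12).
  exists 0%N => // n _ /=; have [k Sk <-] := dD n.
  by exists k => //=; rewrite scalerK.
have [Sr Srr] : dom S (p - l).2 /\ S (p - l).2 = - c *: (p - l).1.
  apply/(selfadjoint_adjoint_rel _ _ sS)/adjoint_relE => k Sk.
  have /= := orth (c *: k, S k) (imageP _ Sk).
  rewrite /inner2/= dotZr scalar_conj_real// dotZl => /eqP.
  by rewrite addrC addr_eq0 mulNr => /eqP.
exists (h, c^-1 *: (p - l).2) => /=; first by split => //; exact: domZ.
rewrite opZ// Srr Shl hl !scalerA mulrN mulVf// mulfV// scaleN1r opprK !scale1r.
by transitivity (l + (p - l)); [|rewrite addrC subrK].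
Qed.

(** The operator matrix splits [H * H] into the pairs [(c h, S h)] and the pairs
    [(- S k, c k)], which are orthogonal by symmetry. So a pair [(u, v)] that is
    orthogonal to the former is one of the latter: this is [kernel] below. Both
    density of the domain and the equality of [S] with its adjoint are
    instances of it. *)
Lemma block_surjective_selfadjoint S c : symmetric_op S ->
  c \is Num.real -> c != 0 -> ran (block_op c S) = setT -> selfadjoint S.
Proof.
move=> sym cR c0 onto.
have inv f g : exists h k,
    [/\ dom S h, dom S k, c *: h - S k = f & S h + c *: k = g].
  have : [set: H * H] (f, g) by [].
  by rewrite -onto => -[[h k] /= [Sh Sk] [<- <-]]; exists h, k.
(* Pairing [(u, v) = (c h - S k, S h + c k)] with [(c h, S h)] leaves
   [c^2 |h|^2 + |S h|^2], since the terms in [k] cancel by symmetry. *)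
have kernel (u v : H) : (forall e, dom S e -> c * '[u, e] + '[v, S e] = 0) ->
    dom S v /\ S v = - c *: u.
  move=> uv; have [h [k [Sh Sk hk1 hk2]]] := inv u v.
  have := uv _ Sh; rewrite -hk1 -hk2 linearBl linearDl/= !dotZl (sym k h)//.
  rewrite mulrBr addrACA addNr addr0 mulrA -expr2 => /eqP.
  have c2 : 0 < c ^+ 2 by rewrite real_exprn_even_gt0.
  rewrite paddr_eq0; [|by rewrite mulr_ge0 ?dot_ge0 ?ltW|exact: dot_ge0].
  rewrite mulf_eq0 (gt_eqF c2)/=.
  move=> /andP[/eqP/dot_eq0 h0 _].
  rewrite h0 op0 scaler0 !add0r opZ// scalerN scaleNr opprK.
  by split=> //; exact: domZ.
(* for [w] orthogonal to the domain, apply [kernel] to [(w, 0)] *)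
have dS : densely_defined S.
  apply: dense_of_orthogonal; [exact: dom0|exact: domP|move=> w wS].
  have [|_] := kernel w 0.
    by move=> e Se; rewrite wS// linear0l mulr0 addr0.
  by rewrite op0 => /esym/eqP; rewrite scaler_eq0 oppr_eq0 (negPf c0) => /eqP.
(* if [l] is the adjoint image of [k], apply [kernel] to [(- l / c, k)] *)
have adj k l : adjoint_rel S k l -> dom S k /\ S k = l.
  move=> /adjoint_relE kl; have [|Sk SkE] := kernel (- c^-1 *: l) k.
    by move=> e Se; rewrite kl// dotZl mulNr mulrN mulVKf// addNr.
  by split=> //; rewrite SkE scalerA mulrNN mulfV// scale1r.
exists dS; split=> [|h Sh].
  apply/seteqP; split=> [k Sk|k [l /adj[]//]].
  by exists (S k) => h Sh; exact: sym.
by have /adj[] : adjoint_rel S h (adjoint_fun S h)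
  by apply: adjoint_funP; exists (S h) => k Sk; exact: sym.
Qed.

(** The product of the matrix [(c, -S; S, c)] with [(c, S; -S, c)] is diagonal
    with entries [c^2 + S^2]; the preimage of [(f, g)] is the image under the
    second matrix of a pair [(u, v)] with [(c^2 + S^2) u = f] and
    [(c^2 + S^2) v = g]. *)
Lemma sqr_surjective_block S c :
  ran (add_scalar_op (c ^+ 2) (sqr_op S)) = setT -> ran (block_op c S) = setT.
Proof.
move=> onto; rewrite -subTset => -[f g] _.
have inv x : exists u, [/\ dom S u, dom S (S u) & c ^+ 2 *: u + S (S u) = x].
  have : [set: H] x by [].
  by rewrite -onto => -[u /= [Su SSu] <-]; exists u.
have [u [Su SSu <-]] := inv f; have [v [Sv SSv <-]] := inv g.
have Scv := domZ c Sv; have Scu := domZ c Su.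
exists (c *: u + S v, - 1 *: S u + c *: v) => /=.
  by split; [exact: domP|apply: domP].
rewrite !op_linear ?opZ// !scaleN1r !scalerDr !scalerA -expr2 scalerN.
rewrite opprD opprK addrACA subrr addr0.
by rewrite [X in (_, X)]addrACA subrr add0r (addrC (S (S v))).
Qed.

(** If the matrix sends [(h, k)] to [(0, f / c)], then [S k = c h] lies in the
    domain of [S] and eliminating [h] gives [(c^2 + S^2) k = f]. *)
Lemma block_surjective_sqr S c : c != 0 ->
  ran (block_op c S) = setT -> ran (add_scalar_op (c ^+ 2) (sqr_op S)) = setT.
Proof.
move=> c0 onto; rewrite -subTset => f _.
have : [set: H * H] (0, c^-1 *: f) by [].
rewrite -onto => -[[h k] /= [Sh Sk] [/eqP]]; rewrite subr_eq0 => /eqP Skh khf.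
have SSk : dom S (S k) by rewrite -Skh; exact: domZ.
exists k => //=.
rewrite -Skh opZ// expr2 -scalerA -scalerDr addrC.
by rewrite khf scalerA mulfV// scale1r.
Qed.

(** By symmetry [<(c^2 + S^2) u, u> = c^2 |u|^2 + |S u|^2], and this is at most
    [|(c^2 + S^2) u| |u|]. *)
Lemma sqr_bounded_below S c u : symmetric_op S -> c \is Num.real ->
  dom S u -> dom S (S u) ->
  c ^+ 2 * `|u| <= `|c ^+ 2 *: u + S (S u)|.
Proof.
move=> sym cR Su SSu.
have [->|u0] := eqVneq u 0; first by rewrite normr0 mulr0.
have c2 : 0 <= c ^+ 2 by rewrite real_exprn_even_ge0.
rewrite -(@ler_pM2r _ `|u|) ?normr_gt0// -mulrA -expr2 sqr_norm_inner.
apply: le_trans (norm_inner _ _).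
rewrite linearDl/= dotZl (sym (S u) u)// ger0_norm.
  by rewrite lerDl dot_ge0.
by apply: addr_ge0; [apply: mulr_ge0 => //|]; exact: dot_ge0.
Qed.

(** As [c^2 + S^2] is bounded below, convergence of its values forces that of
    their preimages, and closedness of [S^2] identifies the limit: the range
    is closed. *)
Lemma dense_range_surjective S c : symmetric_op S -> closed_op (sqr_op S) ->
  c \is Num.real -> c != 0 ->
  closure (ran (add_scalar_op (c ^+ 2) (sqr_op S))) = setT ->
  ran (add_scalar_op (c ^+ 2) (sqr_op S)) = setT.
Proof.
move=> sym cl cR c0 clT; rewrite -subTset => y _.
have : closure (ran (add_scalar_op (c ^+ 2) (sqr_op S))) y by rewrite clT.
move=> /closure_cvg[d dran dy].
have /choice[u uP] n : exists u, [/\ dom S u, dom S (S u)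
    & c ^+ 2 *: u + S (S u) = d n].
  by have [u /= [Su SSu] <-] := dran n; exists u.
have c2 : 0 < c ^+ 2 by rewrite real_exprn_even_gt0.
have [|n m|l ul] := @cauchy_unit_frac _ _ H u (c ^- 2).
- by rewrite invr_ge0 ltW.
- have [Sn SSn dn] := uP n; have [Sm SSm dm] := uP m.
  have [D1 D2] := sqr_domP (-1) (conj Sm SSm) (conj Sn SSn).
  rewrite ler_pdivlMl//.
  have := sqr_bounded_below sym cR D1 D2.
  rewrite (add_scalar_linear (c ^+ 2) (S := sqr_op S))//= dm dn !scaleN1r.
  rewrite ![- _ + _]addrC => /le_trans; apply.
  rewrite -[d n](subrK y) -addrA (le_trans (ler_normD _ _))// distrC.
  by rewrite lerD.
have ulim : (fun n => S (S (u n))) @ \oo --> y - c ^+ 2 *: l.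
  rewrite (_ : (fun _ => _) = fun n => d n - c ^+ 2 *: u n); last first.
    by apply/funext => n; have [_ _ <-] := uP n; rewrite addrC addKr.
  apply: cvgB; last exact: cvgZr.
  by apply: (@cvg_unit_frac _ _ _ _ _ 1) => // n; rewrite mul1r.
have : graph (sqr_op S) (l, y - c ^+ 2 *: l).
  have ulim2 : (fun n => (u n, S (S (u n)))) @ \oo -->
      ((l, y - c ^+ 2 *: l) : H * H) by exact: cvg_pair.
  apply: (closed_cvg _ cl _ _ ulim2).
  by exists 0%N => // n _ /=; have [? ? _] := uP n; exists (u n).
move=> [k /= Sk [kl SSk]]; exists k => //=.
by rewrite SSk kl addrC subrK.
Qed.

End Operators.

(** * The characterisations of selfadjointness *)

Theorem corollary3p6 (R : realType) (s : scalar_kind) (H : hilbertType R s)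
    (S : linop H) :
  [<-> selfadjoint S;
       symmetric_op S /\
         (exists lambda : scalars R s, [/\ lambda \is Num.real, lambda != 0
            & ran (block_op lambda S) = setT]);
       symmetric_op S /\
         (forall lambda : scalars R s, lambda \is Num.real -> lambda != 0 ->
            ran (block_op lambda S) = setT);
       [/\ closed_op S /\ densely_defined S, symmetric_op S
         & exists lambda : scalars R s, [/\ lambda \is Num.real, lambda != 0
            & ran (add_scalar_op (lambda ^+ 2) (sqr_op S)) = setT]];
       [/\ closed_op S /\ densely_defined S, symmetric_op S
         & forall lambda : scalars R s, lambda \is Num.real -> lambda != 0 ->
            ran (add_scalar_op (lambda ^+ 2) (sqr_op S)) = setT]]
  /\
  (closed_op (sqr_op S) ->
   [<-> selfadjoint S;
       [/\ closed_op S /\ densely_defined S, symmetric_op S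
         & exists lambda : scalars R s, [/\ lambda \is Num.real, lambda != 0
            & closure (ran (add_scalar_op (lambda ^+ 2) (sqr_op S))) = setT]];
       [/\ closed_op S /\ densely_defined S, symmetric_op S
         & forall lambda : scalars R s, lambda \is Num.real -> lambda != 0 ->
            closure (ran (add_scalar_op (lambda ^+ 2) (sqr_op S))) = setT]]).
Proof.
have one_real : (1 : scalars R s) \is Num.real by exact: rpred1.
have one_neq0 : (1 : scalars R s) != 0 by exact: oner_neq0.
have sa_block : selfadjoint S -> forall c : scalars R s,
    c \is Num.real -> c != 0 -> ran (block_op c S) = setT.
  by move=> sS c; exact: selfadjoint_block_surjective.
have sa_sqr : selfadjoint S -> forall c : scalars R s,
    c \is Num.real -> c != 0 -> ran (add_scalar_op (c ^+ 2) (sqr_op S)) = setT.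
  by move=> sS c cR c0; apply: block_surjective_sqr => //; exact: sa_block.
have sqr_sa : symmetric_op S -> forall c : scalars R s, c \is Num.real ->
    c != 0 -> ran (add_scalar_op (c ^+ 2) (sqr_op S)) = setT -> selfadjoint S.
  move=> sym c cR c0 onto; apply: (block_surjective_selfadjoint sym cR c0).
  exact: sqr_surjective_block.
have sa_sym := @selfadjoint_symmetric R s H S.
have sa_cd : selfadjoint S -> closed_op S /\ densely_defined S.
  by move=> sS; split; [exact: selfadjoint_closed|case: sS].
split=> [|cl].
  tfae.
  - by move=> sS; split; [exact: sa_sym|exists 1; split=> //; exact: sa_block].
  - move=> [sym [c [cR c0 onto]]]; split=> //; apply: sa_block.
    exact: (block_surjective_selfadjoint sym cR c0 onto).
  - move=> [sym onto].
    have sS : selfadjoint S.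
      by apply: (block_surjective_selfadjoint sym one_real) => //; exact: onto.
    by split; [exact: sa_cd|by []|exists 1; split=> //; exact: sa_sqr].
  - move=> [cd sym [c [cR c0 onto]]]; split=> //.
    by apply/sa_sqr/(sqr_sa sym c).
  - by move=> [_ sym onto]; apply: (sqr_sa sym 1) => //; exact: onto.
have closure_onto : symmetric_op S -> forall c : scalars R s, c \is Num.real ->
    c != 0 -> closure (ran (add_scalar_op (c ^+ 2) (sqr_op S))) = setT ->
    selfadjoint S.
  move=> sym c cR c0 clT; apply: (sqr_sa sym c cR c0).
  exact: dense_range_surjective.
have sa_closure : selfadjoint S -> forall c : scalars R s,
    c \is Num.real -> c != 0 ->
    closure (ran (add_scalar_op (c ^+ 2) (sqr_op S))) = setT.
  by move=> sS c cR c0; rewrite sa_sqr// closureT.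
tfae.
- move=> sS; split; [exact: sa_cd|exact: sa_sym|].
  by exists 1; split=> //; exact: sa_closure.
- move=> [cd sym [c [cR c0 clT]]]; split=> //.
  by apply/sa_closure/(closure_onto sym c).
- by move=> [_ sym clT]; apply: (closure_onto sym 1) => //; exact: clT.
Qed.
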